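(* Let $\rho\in\mathcal P$ be a cumulative bid distribution function. Then: (1) $\hat V_\rho$ is a continuous increasing function on $\mathbb R^+$. (2) $\hat\theta_\rho$ is a continuous strictly increasing function on $\mathbb R^+$.
   Context: Notation: $\mathbb R^+=[0,\infty)$, $z^+=\max(z,0)$. Fix an integer $M\ge 2$ and $\beta\in(0,1)$. Let $\Phi$ be a probability distribution (of job arrivals) on $[0,\bar A]$, $\bar A<\infty$, with a bounded density. The holding cost $C:\mathbb R^+\to\mathbb R^+$ is continuous, increasing, strictly convex, and $C(q)=O(q^m)$ for some integer $m$. $\mathcal P=\{G: G \text{ is a continuous c.d.f. of a probability measure on }\mathbb R^+,\ \int_0^\infty(1-G(x))\,dx<E\}$ for a fixed finite $E$. For $\rho\in\mathcal P$: $p_\rho(x)=\rho(x)^{M-1}$ and $r_\rho(x)=xp_\rho(x)-\int_0^xp_\rho(u)\,du$. $\hat V_\rho(q)=\inf_\theta\mathbb E\big[\sum_{t\ge0}\beta^t(C(Q_t)+r_\rho(\theta(Q_t)))\mid Q_0=q\big]$, the infimum over measurable $\theta:\mathbb R^+\to\mathbb R^+$, where, given $Q_t$, $Q_{t+1}=(Q_t-1)^++A_t$ with probability $p_\rho(\theta(Q_t))$ and $Q_{t+1}=Q_t+A_t$ otherwise, $A_t$ i.i.d. $\sim\Phi$. $\hat\theta_\rho(q)=\beta\,\big(\mathbb E_{A\sim\Phi}[\hat V_\rho(q+A)-\hat V_\rho((q-1)^++A)]\big)^+$. *)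

(* Defs.v *)
From HB Require Import structures.
From mathcomp Require Import all_boot all_order all_algebra.
From mathcomp Require Import all_classical all_reals all_analysis.

Set Implicit Arguments.
Unset Strict Implicit.
Unset Printing Implicit Defensive.
Import Order.TTheory GRing.Theory Num.Theory.
Import numFieldNormedType.Exports.
Local Open Scope classical_set_scope.
Local Open Scope ring_scope.

(* Functions on R^+ = [0, +oo[ are represented by functions R -> R whose values
   outside [0, +oo[ are irrelevant: hypotheses and conclusions about them are
   restricted to [0, +oo[. *)

Definition pos_part (R : realType) (z : R) : R := Num.max z 0.

Definition distribution_on (R : realType) (Phi : probability R R) (a b : R) :=
  Phi `[a, b]%classic = 1%E.

Definition has_bounded_density (R : realType) (Phi : probability R R) :=
  exists (f : R -> R) (K : R),
    [/\ measurable_fun setT f,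
        forall x, 0 <= f x <= K &
        forall B, measurable B ->
          Phi B = (\int[lebesgue_measure]_(x in B) (f x)%:E)%E].

Definition strictly_convex_on (R : realType) (D : set R) (f : R -> R) :=
  forall x y t : R, D x -> D y -> x != y -> 0 < t -> t < 1 ->
    f (t * x + (1 - t) * y) < t * f x + (1 - t) * f y.

Definition holding_cost (R : realType) (C : R -> R) :=
  [/\ forall q, 0 <= q -> 0 <= C q,
      {within `[0, +oo[, continuous C},
      forall x y, 0 <= x -> x <= y -> C x <= C y,
      strictly_convex_on `[0, +oo[%classic C &
      exists (m : nat) (k : R), \forall q \near +oo, C q <= k * q ^+ m].

(* The c.d.f. is continuous on the whole line, so its law has no atom, not even
   at 0. *)
Definition bid_cdf (R : realType) (E : R) (G : R -> R) :=
  [/\ exists2 mu : probability R R,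
        mu `[0, +oo[%classic = 1%E & forall x, (G x)%:E = mu `]-oo, x]%classic,
      continuous G &
      (\int[lebesgue_measure]_(x in `[0%R, +oo[) (1 - G x)%:E < E%:E)%E].

Definition win_prob (R : realType) (M : nat) (rho : R -> R) (x : R) : R :=
  rho x ^+ (M - 1).

Definition payment (R : realType) (M : nat) (rho : R -> R) (x : R) : R :=
  x * win_prob M rho x
  - \int[lebesgue_measure]_(u in `[0, x]) win_prob M rho u.

Definition bid_policy (R : realType) (theta : R -> R) :=
  measurable_fun (`[0, +oo[%classic : set R) theta /\ forall q, 0 <= q -> 0 <= theta q.

Definition mutually_independent d (T : measurableType d) (R : realType)
    (P : probability T R) (I : choiceType) (X : I -> T -> R) :=
  forall (s : seq I) (B : I -> set R), uniq s ->
    (forall i, measurable (B i)) ->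
    P (\bigcap_(i in [set` s]) (X i @^-1` B i))
    = (\prod_(i <- s) P (X i @^-1` B i))%E.

(* The primitive randomness of the queue: arrivals A_t with law Phi and
   variables U_t uniform on [0, 1], all mutually independent.  The event
   U_t < p realizes the win of the auction, which has conditional probability p
   given the past and A_t.  Arrivals are nonnegative everywhere, not just almost
   surely, so that the queue never leaves [0, +oo[. *)
Definition queue_inputs d (Omega : measurableType d) (R : realType)
    (P : probability Omega R) (Phi : probability R R)
    (A U : nat -> {RV P >-> R}) :=
  [/\ forall t w, 0 <= A t w,
      forall t B, measurable B -> distribution P (A t) B = Phi B,
      forall t B, measurable B ->
        distribution P (U t) B = uniform_prob (@ltr01 R) B &
      mutually_independent P
        (fun i : nat + nat => match i with
           | inl t => A t : Omega -> R
           | inr t => U t : Omega -> R end)].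

Section Queue.
Context d (Omega : measurableType d) (R : realType) (P : probability Omega R).
Variables (A U : nat -> {RV P >-> R}) (M : nat) (beta : R) (C rho : R -> R).

Fixpoint queue (theta : R -> R) (q : R) (t : nat) (w : Omega) : R :=
  match t with
  | 0%N => q
  | s.+1 => let x := queue theta q s w in
      (if U s w < win_prob M rho (theta x) then pos_part (x - 1) else x)
      + A s w
  end.

Definition discounted_cost (theta : R -> R) (q : R) : \bar R :=
  (\int[P]_w \sum_(0 <= t <oo)
    (beta ^+ t * (C (queue theta q t w)
                  + payment M rho (theta (queue theta q t w))))%:E)%E.

Definition value_ereal (q : R) : \bar R :=
  ereal_inf [set discounted_cost theta q | theta in @bid_policy R].

Definition value (q : R) : R := fine (value_ereal q).

(* The expectation over Phi is taken on [0, Abar], which carries Phi, because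
   value is meaningful on [0, +oo[ only. *)
Definition best_bid (Phi : probability R R) (Abar : R) (q : R) : R :=
  beta * pos_part (\int[Phi]_(a in `[0, Abar])
                     (value (q + a) - value (pos_part (q - 1) + a))).

End Queue.

(* Main.v *)
(* Write W f q = E f(q + A), D f q = beta (W f q - W f (q - 1)^+) and
   psi x = \int_0^x p.  Since p is nondecreasing, a bidder whose gain from
   winning is D minimizes x p x - psi x - D p x at x = D, with minimum - psi D,
   so the Bellman operator is T f = C + beta W f - psi (D f).  It need not
   preserve convexity, but psi is nondecreasing and 1-Lipschitz with psi 0 = 0,
   and
     T f q - T f (q - 1)^+ = C q - C (q - 1)^+ + (D f q - psi (D f q))
                             + psi (D f (q - 1)^+),
   so T preserves continuity, monotonicity and monotonicity of
   f q - f (q - 1)^+.  The iterates T^n 0 increase by at most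
   beta^n C (q + n Abar) per step, hence converge locally uniformly to a fixed
   point V of T, for which strict convexity of C makes D V strictly increasing.

   As the inputs of step t are independent of Q_t, for every policy
   E[beta^t T f Q_t] <= E[cost of step t] + E[beta^(t+1) f Q_(t+1)], with
   equality for the policy D f.  Iterating on f = T^n 0 bounds the cost of every
   policy below by T^n 0; iterating the equality on f = V bounds the cost of the
   policy D V above by V.  Hence V is the value function and D V the best bid. *)
Require Import Defs.
From HB Require Import structures.
From mathcomp Require Import all_boot all_order all_algebra.
From mathcomp Require Import all_classical all_reals all_analysis.
From mathcomp Require Import measurable_realfun ring lra.

Set Implicit Arguments.
Unset Strict Implicit.
Unset Printing Implicit Defensive.
Import Order.TTheory GRing.Theory Num.Theory.
Import numFieldNormedType.Exports.
Local Open Scope classical_set_scope.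
Local Open Scope ring_scope.

(** * Positive part, and boundedness of continuous functions on segments *)

Section PositivePart.
Context {R : realType}.
Implicit Types x y z : R.

Lemma pos_part_ge0 z : 0 <= pos_part z.
Proof. by rewrite /pos_part le_max lexx orbT. Qed.

Lemma pos_part_id z : 0 <= z -> pos_part z = z.
Proof. by move=> z0; rewrite /pos_part; apply/max_idPl. Qed.

Lemma pos_part_le0 z : z <= 0 -> pos_part z = 0.
Proof. by move=> z0; rewrite /pos_part; apply/max_idPr. Qed.

Lemma pos_part_nondecreasing x y : x <= y -> pos_part x <= pos_part y.
Proof. by move=> xy; rewrite /pos_part ge_max !le_max xy lexx orbT. Qed.

Lemma pos_part_subr1_le x : 0 <= x -> pos_part (x - 1) <= x.
Proof. by move=> x0; rewrite /pos_part ge_max x0 lerBlDr lerDl ler01. Qed.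

Lemma continuous_pos_part : continuous (@pos_part R).
Proof.
move=> x; rewrite /pos_part.
by apply: (@continuous_max R R (fun z => z) (fun=> 0) x) => //; exact: cst_continuous.
Qed.

Lemma continuous_pos_part_subr1 : continuous (fun x : R => pos_part (x - 1)).
Proof.
move=> x; apply: (continuous_comp (f := fun z : R => z - 1) (g := @pos_part R)).
  by apply: continuousB => //; exact: cst_continuous.
exact: continuous_pos_part.
Qed.

Lemma continuous_bounded_itv (f : R -> R) : continuous f ->
  forall a b : R, exists2 K : R, 0 <= K & forall x, a <= x <= b -> `|f x| <= K.
Proof.
move=> fc a b; have [ab|ba] := leP a b; last first.
  by exists 0 => // x /andP[ax xb]; have := le_lt_trans (le_trans ax xb) ba; rewrite ltxx.
have [c _ Hc] : exists2 c, c \in `[a, b] & forall t, t \in `[a, b] -> `|f t| <= `|f c|.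
  apply: (@EVT_max R (fun x => `|f x|)) => //.
  apply: continuous_subspaceT => x; apply: continuous_comp; first exact: fc.
  exact: norm_continuous.
by exists `|f c| => // x xab; apply: Hc; rewrite in_itv.
Qed.

End PositivePart.

(** * The integrated win probability [psi] and the payment rule *)

Section IncrementalPayment.
Context {R : realType} (p : R -> R).
Hypothesis p_continuous : continuous p.
Hypothesis p_nondecreasing : forall x y, x <= y -> p x <= p y.
Hypothesis p_range : forall x, 0 <= p x <= 1.

Definition psi (x : R) : R := \int[lebesgue_measure]_(u in `[0, x]) p u.

Lemma psi_le0 x : x <= 0 -> psi x = 0.
Proof.
move=> x0; rewrite /psi /Rintegral.
have -> : `[0, x]%classic = if x == 0 then [set 0 : R] else set0.
  case: eqVneq => [->|xn0]; first by rewrite set_itv1.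
  by rewrite set_itv_ge // bnd_simp -ltNge lt_neqAle xn0.
by case: ifP => _; rewrite ?integral_set1 ?integral_set0.
Qed.

(** On []a, b]] the integrand lies between [p a] and [p b]. Monotonicity of [psi], its Lipschitz
    bound and the optimality of truthful bids all come from this. *)
Lemma psi_slope a b : 0 <= a -> a <= b ->
  (b - a) * p a <= psi b - psi a <= (b - a) * p b.
Proof.
move=> a0 ab.
have pint x y : lebesgue_measure.-integrable `[x, y] (EFin \o p).
  apply: continuous_compact_integrable; first exact: segment_compact.
  exact: continuous_subspaceT.
(* The difference of the two integrals is taken over the half-open []a, b]]. *)
have oc_int (g : R -> R) : continuous g -> lebesgue_measure.-integrable `]a, b] (EFin \o g).
  move=> gc; have gi : lebesgue_measure.-integrable `[a, b] (EFin \o g).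
    apply: continuous_compact_integrable; first exact: segment_compact.
    exact: continuous_subspaceT.
  by apply: (integrableS _ _ _ gi) => //; apply: subset_itv_oc_cc.
have pint' := oc_int p p_continuous.
have cint (k : R) := oc_int _ (@cst_continuous R R k).
rewrite /psi Rintegral_itvB //.
have H (k : R) : \int[lebesgue_measure]_(x in `]a, b]) k = (b - a) * k.
  rewrite Rintegral_cst ?lebesgue_measure_itv //= lebesgue_measure_itv /= lte_fin.
  case: ltP => [_|ba]; first by rewrite mulrC.
  by have -> : b = a; [apply/eqP; rewrite eq_le ab ba | rewrite subrr mul0r mulr0].
apply/andP; split; rewrite -H; apply: le_Rintegral => // x /=;
  rewrite in_itv/= => /andP[ax xb]; apply: p_nondecreasing => //; exact: ltW.
Qed.

Lemma psi_pos_part x : psi (pos_part x) = psi x.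
Proof.
have [x0|x0] := leP 0 x; first by rewrite pos_part_id.
by rewrite pos_part_le0 ?ltW// !psi_le0 // ltW.
Qed.

Lemma psi_nondecreasing x y : x <= y -> psi x <= psi y.
Proof.
move=> /pos_part_nondecreasing xy; rewrite -(psi_pos_part x) -(psi_pos_part y).
rewrite -subr_ge0; have /andP[+ _] := psi_slope (pos_part_ge0 x) xy.
apply: le_trans; apply: mulr_ge0; first by rewrite subr_ge0.
by case/andP: (p_range (pos_part x)).
Qed.

(** Slopes of [psi] are at most [p <= 1], and clipping at 0 is itself 1-Lipschitz. *)
Lemma psi_subr_le x y : x <= y -> psi y - psi x <= y - x.
Proof.
move=> xy; have xy' := pos_part_nondecreasing xy.
rewrite -(psi_pos_part x) -(psi_pos_part y).
have /andP[_ h] := psi_slope (pos_part_ge0 x) xy'; apply: (le_trans h).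
apply: (@le_trans _ _ (pos_part y - pos_part x)).
  by rewrite ler_piMr ?subr_ge0//; case/andP: (p_range (pos_part y)).
rewrite /pos_part; case: (leP x 0) => x0; case: (leP y 0) => y0; lra.
Qed.

Lemma continuous_psi : continuous psi.
Proof.
move=> x; apply/cvgrPdist_le => /= e e0; near=> y.
have : `|x - y| <= e by near: y; apply: cvgr_dist_le.
apply: le_trans; have [xy|/ltW yx] := leP x y.
  have := psi_nondecreasing xy; have := psi_subr_le xy => h1 h2.
  by rewrite distrC (distrC x) !ger0_norm ?subr_ge0.
have := psi_nondecreasing yx; have := psi_subr_le yx => h1 h2.
by rewrite !ger0_norm ?subr_ge0.
Unshelve. all: by end_near. Qed.

(* Truthful bidding: the payment rule makes the bid [D] a best response to the
   marginal value [D]. *)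
Lemma payment_ge D x : 0 <= D -> 0 <= x -> p x * D - psi D <= x * p x - psi x.
Proof.
move=> D0 x0; have [Dx|/ltW xD] := leP D x.
  by have /andP[_] := psi_slope D0 Dx; lra.
by have /andP[+ _] := psi_slope x0 xD; lra.
Qed.

Lemma payment_ge0 x : 0 <= x -> 0 <= x * p x - psi x.
Proof. by move=> x0; have := @payment_ge 0 x (lexx _) x0; rewrite (psi_le0 (lexx 0)); lra. Qed.

End IncrementalPayment.

(** * Averaging over one arrival *)

Section ArrivalMean.
Context {R : realType} (Phi : probability R R) (Abar : R).
Hypothesis Phi_supp : distribution_on Phi 0 Abar.
Implicit Types f g : R -> R.

Definition arrival_mean f (q : R) : R := \int[Phi]_(a in `[0, Abar]) f (q + a).

Local Notation W := arrival_mean.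

Lemma Abar_ge0 : 0 <= Abar.
Proof.
rewrite leNgt; apply/negP => h; have := Phi_supp.
by rewrite /distribution_on set_itv_ge ?bnd_simp -?ltNge// measure0 => /eqP; rewrite eq_sym onee_eq0.
Qed.

(** A continuous [f] is bounded on the segment from [q] to [q + Abar], whatever its growth at
    infinity. *)
Lemma arrival_integrable f q : continuous f ->
  Phi.-integrable `[0, Abar] (EFin \o (fun a => f (q + a))).
Proof.
move=> fc.
apply: measurable_bounded_integrable => //.
- by apply: (@le_lt_trans _ _ 1%E); [exact: probability_le1 | rewrite ltry].
- apply: measurable_funTS; apply: continuous_measurable_fun => x.
  apply: continuous_comp; last exact: fc.
  by apply: continuousD => //; exact: cst_continuous.
- have [K K0 HK] := continuous_bounded_itv fc q (q + Abar).
  exists K; split; first exact: num_real.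
  move=> k Kk a /=; rewrite in_itv/= => /andP[a0 aA].
  by apply: le_trans (ltW Kk); apply: HK; rewrite lerDl a0 lerD2l.
Qed.

Lemma arrival_mean_cst (k : R) : \int[Phi]_(a in `[0, Abar]) k = k.
Proof.
rewrite Rintegral_cst//; transitivity (k * fine (1%E : \bar R)); last by rewrite mulr1.
by congr (_ * fine _); exact: Phi_supp.
Qed.

(** Two base points and two functions serve both monotonicity in the state and comparison of value
    functions. The slack [k] carries approximation errors, and strict gaps when negative. *)
Lemma arrival_mean_leD f g q r (k : R) : continuous f -> continuous g ->
  (forall a, 0 <= a <= Abar -> f (q + a) <= g (r + a) + k) -> W f q <= W g r + k.
Proof.
move=> fc gc h; rewrite -[k in _ + k](arrival_mean_cst k).
have ik : Phi.-integrable `[0, Abar] (EFin \o (fun=> k)).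
  exact: (arrival_integrable 0 (@cst_continuous R R k)).
rewrite /W -RintegralD //; last exact: arrival_integrable.
apply: le_Rintegral => //; first exact: arrival_integrable.
- apply: (arrival_integrable (f := fun x => g x + k)) => // x.
  by apply: continuousD; [exact: gc|exact: cst_continuous].
Qed.

Lemma arrival_mean_le f g q r : continuous f -> continuous g ->
  (forall a, 0 <= a <= Abar -> f (q + a) <= g (r + a)) -> W f q <= W g r.
Proof.
move=> fc gc h; rewrite -[W g r]addr0; apply: arrival_mean_leD => // a /h.
by rewrite addr0.
Qed.

Lemma continuous_shift f q : continuous f -> continuous (fun a => f (q + a)).
Proof.
move=> fc x; apply: continuous_comp; last exact: fc.
by apply: continuousD => //; exact: cst_continuous.
Qed.

(* The gap is continuous in the arrival, so it is bounded away from 0 on the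
   compact support of [Phi]. *)
Lemma arrival_mean_lt f g q r : continuous f -> continuous g ->
  (forall a, 0 <= a <= Abar -> f (q + a) < g (r + a)) -> W f q < W g r.
Proof.
move=> fc gc h.
have [c c01 Hc] : exists2 c, c \in `[0, Abar] &
    forall t, t \in `[0, Abar] -> g (r + c) - f (q + c) <= g (r + t) - f (q + t).
  apply: (@EVT_min R (fun t => g (r + t) - f (q + t))); first exact: Abar_ge0.
  apply: continuous_subspaceT => x; apply: continuousB; exact: continuous_shift.
have := c01; rewrite in_itv => /h; rewrite -subr_gt0 => e0.
apply: (@lt_le_trans _ _ (W f q + (g (r + c) - f (q + c)))); first by rewrite ltrDl.
rewrite -lerBrDr; apply: arrival_mean_leD => // a a01.
by have := Hc a; rewrite in_itv a01 => /(_ isT); lra.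
Qed.

Lemma arrival_meanB f g q r : continuous f -> continuous g ->
  \int[Phi]_(a in `[0, Abar]) (f (q + a) - g (r + a)) = W f q - W g r.
Proof. by move=> fc gc; rewrite RintegralB //; exact: arrival_integrable. Qed.

(** Moves the unit shift under the mean, so that monotone unit increments of [f] pass to [W f]. *)
Lemma arrival_mean_increment f q : continuous f ->
  W f q - W f (q - 1) = W (fun z => f z - f (z - 1)) q.
Proof.
move=> fc; rewrite -(arrival_meanB q (q - 1) fc fc).
by apply: eq_Rintegral => a _; rewrite addrAC.
Qed.

Lemma arrival_mean_cst0 q : W (fun=> 0) q = 0.
Proof. exact: arrival_mean_cst. Qed.

Lemma arrival_mean_ge0 f q : (forall x, 0 <= f x) -> 0 <= W f q.
Proof. by move=> f0; apply: Rintegral_ge0. Qed.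

Lemma continuous_arrival_mean f : continuous f -> continuous (W f).
Proof.
move=> fc q.
(* Dominated convergence: [K] bounds [f] at every state within 1 of [q] and every arrival up to
   [Abar]. *)
have [K K0 HK] := continuous_bounded_itv fc (q - 1) (q + 1 + Abar).
apply: (@continuity_under_integral R _ _ Phi (fun x a => f (x + a)) `[0, Abar]
    (measurable_itv _) (q - 1) (q + 1) _ _ (fun=> K)).
- by move=> x _; exact: arrival_integrable.
- apply: aeW => y _ x _; apply: (continuous_comp (f := fun z : R => z + y)); last exact: fc.
  by apply: continuousD => //; exact: cst_continuous.
- exact: (arrival_integrable 0 (@cst_continuous R R K)).
- move=> x /=; rewrite in_itv/= => /andP[qx xq]; apply: aeW => y /=.
  by rewrite in_itv/= => /andP[y0 yA]; apply: HK; lra.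
- by rewrite inE/= in_itv/=; lra.
Qed.

End ArrivalMean.

(** * The Bellman operator and the properties it preserves *)

Section Bellman.
Context {R : realType} (p c : R -> R) (Phi : probability R R) (Abar beta : R).
Hypothesis p_continuous : continuous p.
Hypothesis p_nondecreasing : forall x y, x <= y -> p x <= p y.
Hypothesis p_range : forall x, 0 <= p x <= 1.
Hypothesis Phi_supp : distribution_on Phi 0 Abar.
Hypothesis beta_range : 0 < beta < 1.
Implicit Types f g : R -> R.

Local Notation W := (arrival_mean Phi Abar).
Local Notation psi := (psi p).

(** This becomes the best bid when [f] is the value function. Clipping [q] gives a continuous
    function on the whole line; no outer positive part appears because the gain is nonnegative for
    admissible [f]. *)
Definition win_gain f (q : R) : R :=
  beta * (W f (pos_part q) - W f (pos_part (q - 1))).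

(* Minimizing over bids gives - [psi (win_gain f q)]. *)
Definition bellman f (q : R) : R :=
  c q + beta * W f (pos_part q) - psi (win_gain f q).

(* Value iteration need not preserve convexity, but it does preserve
   monotonicity of [f q - f (q - 1)^+]. *)
Record admissible f : Prop := Admissible {
  adm_continuous : continuous f;
  adm_ge0 : forall q, 0 <= f q;
  adm_nondecreasing : forall x y, x <= y -> f x <= f y;
  adm_increment : forall x y, 0 <= x -> x <= y ->
    f x - f (pos_part (x - 1)) <= f y - f (pos_part (y - 1)) }.

Hypothesis c_admissible : admissible c.

Let beta_gt0 : 0 < beta. Proof. by case/andP: beta_range. Qed.
Let beta_ge0 : 0 <= beta. Proof. exact: ltW. Qed.

Lemma adm_cst0 : admissible (fun=> 0).
Proof. by split=> //; exact: cst_continuous. Qed.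

Lemma arrival_mean_nondecreasing f x y : admissible f -> x <= y -> W f x <= W f y.
Proof.
move=> af xy; apply: (arrival_mean_le Phi_supp (adm_continuous af) (adm_continuous af)) => a _.
by apply: (adm_nondecreasing af); rewrite lerD2r.
Qed.

Lemma win_gain_ge0 f q : admissible f -> 0 <= win_gain f q.
Proof.
move=> af; apply: mulr_ge0 => //; rewrite subr_ge0.
by apply: arrival_mean_nondecreasing => //; apply: pos_part_nondecreasing; lra.
Qed.

Lemma continuous_win_gain f : admissible f -> continuous (win_gain f).
Proof.
move=> af q; have Wc := continuous_arrival_mean (adm_continuous af).
apply: cvgM; first exact: cvg_cst.
apply: cvgB.
  by apply: continuous_comp; [exact: continuous_pos_part|exact: Wc].
by apply: (continuous_comp (f := fun z : R => pos_part (z - 1)) (g := W f));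
  [exact: continuous_pos_part_subr1|exact: Wc].
Qed.

Lemma win_gain_below1 f q : 0 <= q <= 1 -> win_gain f q = beta * (W f q - W f 0).
Proof.
move=> /andP[q0 q1]; rewrite /win_gain (pos_part_id q0) [pos_part (q - 1)]pos_part_le0 //.
by rewrite subr_le0.
Qed.

Lemma win_gain_above1 f q : continuous f -> 1 <= q ->
  win_gain f q = beta * W (fun z => f z - f (z - 1)) q.
Proof.
move=> fc q1; have q0 : 0 <= q by apply: le_trans q1.
rewrite /win_gain (pos_part_id q0) [pos_part (q - 1)]pos_part_id ?subr_ge0//.
by rewrite arrival_mean_increment.
Qed.

Lemma continuous_unit_increment f : continuous f -> continuous (fun z => f z - f (z - 1)).
Proof.
move=> fc z; apply: cvgB; first exact: fc.
apply: (continuous_comp (f := fun z : R => z - 1) (g := f)); last exact: fc.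
by apply: cvgB; [exact: cvg_id|exact: cvg_cst].
Qed.

(* For [q <= 1] the loss of one unit empties the queue, so monotonicity of [f]
   suffices; for [q >= 1] the increments of [f] over unit steps are needed. *)
Lemma win_gain_le f x y : admissible f -> 0 <= x -> x <= y ->
  win_gain f x <= win_gain f y.
Proof.
move=> af.
have below (x' y' : R) : 0 <= x' -> x' <= y' -> y' <= 1 -> win_gain f x' <= win_gain f y'.
  move=> x0 xy y1; rewrite !win_gain_below1; [|lra|lra].
  by rewrite ler_pM2l// lerD2r; exact: arrival_mean_nondecreasing.
have above (x' y' : R) : 1 <= x' -> x' <= y' -> win_gain f x' <= win_gain f y'.
  move=> x1 xy; have fc := adm_continuous af.
  have dc := continuous_unit_increment fc.
  rewrite !(win_gain_above1 fc); [|lra|lra].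
  rewrite ler_pM2l//; apply: (arrival_mean_le Phi_supp dc dc) => a /andP[a0 _].
  have xa0 : 0 <= x' + a by lra.
  have xya : x' + a <= y' + a by lra.
  have := adm_increment af xa0 xya.
  by rewrite !pos_part_id; lra.
move=> x0 xy; have [y1|/ltW y1] := leP y 1; first exact: below.
have [x1|/ltW x1] := leP x 1; last exact: above.
by apply: (@le_trans _ _ (win_gain f 1)); [exact: below|exact: above].
Qed.

(** Same split at 1 as in [win_gain_le]: strict growth of [f] handles states below 1, strict growth
    of its unit increments handles states above. *)
Lemma win_gain_lt f x y : continuous f ->
  (forall x y, 0 <= x -> x < y -> f x < f y) ->
  (forall x y, 0 <= x -> x < y ->
    f x - f (pos_part (x - 1)) < f y - f (pos_part (y - 1))) ->
  0 <= x -> x < y -> win_gain f x < win_gain f y.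
Proof.
move=> fc f_incr f_diff.
have below (x' y' : R) : 0 <= x' -> x' < y' -> y' <= 1 -> win_gain f x' < win_gain f y'.
  move=> x0 xy y1; rewrite !win_gain_below1; [|lra|lra].
  rewrite ltr_pM2l// ltrD2r; apply: (arrival_mean_lt Phi_supp fc fc) => a /andP[a0 _].
  by apply: f_incr; lra.
have above (x' y' : R) : 1 <= x' -> x' < y' -> win_gain f x' < win_gain f y'.
  move=> x1 xy; have dc := continuous_unit_increment fc.
  rewrite !(win_gain_above1 fc); [|lra|lra].
  rewrite ltr_pM2l//; apply: (arrival_mean_lt Phi_supp dc dc) => a /andP[a0 _].
  have xa0 : 0 <= x' + a by lra.
  have xya : x' + a < y' + a by lra.
  have := f_diff _ _ xa0 xya.
  by rewrite !pos_part_id; lra.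
move=> x0 xy; have [y1|y1] := leP y 1; first exact: below.
have [x1|x1] := ltP x 1; last exact: above.
by apply: (@lt_trans _ _ (win_gain f 1)); [exact: below|exact: above].
Qed.

(** With continuation costs [w] after a loss and [v] after a win, [w - psi (w - v)] is the
    continuation cost net of the optimal bid. If the gap [w - v] grows, the 1-Lipschitz bound on
    [psi] leaves at least [v' - v]; if it shrinks, [psi] decreases while [w] increases. *)
Lemma loss_gain_le (w v w' v' : R) : v <= w -> v' <= w' -> w <= w' -> v <= v' ->
  w - psi (w - v) <= w' - psi (w' - v').
Proof.
move=> vw vw' ww' vv'.
have [h|/ltW h] := leP (w - v) (w' - v').
  by have := psi_subr_le p_continuous p_nondecreasing p_range h; lra.
by have := psi_nondecreasing p_continuous p_nondecreasing p_range h; lra.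
Qed.

Lemma bellmanE f q : bellman f q = c q + (beta * W f (pos_part q) -
  psi (beta * W f (pos_part q) - beta * W f (pos_part (q - 1)))).
Proof. by rewrite /bellman /win_gain mulrBr addrA. Qed.

Lemma bellman_le f g q : admissible f -> admissible g ->
  (forall x, 0 <= x -> f x <= g x) -> bellman f q <= bellman g q.
Proof.
move=> af ag fg; rewrite !bellmanE lerD2l.
have h x : beta * W f (pos_part x) <= beta * W g (pos_part x).
  rewrite ler_pM2l//; apply: (arrival_mean_le Phi_supp);
    try exact: adm_continuous; move=> a /andP[a0 _].
  by apply: fg; apply: addr_ge0 => //; exact: pos_part_ge0.
by apply: loss_gain_le => //; rewrite ler_pM2l//;
  apply: arrival_mean_nondecreasing => //; apply: pos_part_nondecreasing; lra.
Qed.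

(** The comparison is required only on states reachable in one step, since value functions may be
    unbounded and converge only locally uniformly. *)
Lemma bellman_leD f g q e : admissible f -> admissible g ->
  (forall x, 0 <= x <= pos_part q + Abar -> g x <= f x + e) ->
  bellman g q <= bellman f q + beta * e.
Proof.
move=> af ag fg; rewrite !bellmanE -addrA lerD2l.
have h x : x <= q -> beta * W g (pos_part x) <= beta * W f (pos_part x) + beta * e.
  move=> xq; rewrite -mulrDr ler_pM2l//; apply: (arrival_mean_leD Phi_supp);
    try exact: adm_continuous; move=> a /andP[a0 aA].
  apply: fg; rewrite addr_ge0 ?pos_part_ge0//=.
  by apply: lerD => //; apply: pos_part_nondecreasing.
have hq := h q (lexx q); have hq1 := h (q - 1).
have mon f' : admissible f' ->
    beta * W f' (pos_part (q - 1)) <= beta * W f' (pos_part q).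
  move=> af'; rewrite ler_pM2l//.
  by apply: arrival_mean_nondecreasing => //; apply: pos_part_nondecreasing; lra.
have := mon f af; have := mon g ag => mg mf.
set w := beta * W f _ in hq mf *; set v := beta * W f _ in hq1 mf *.
(* Raising both continuation costs by [beta * e] keeps their gap, so the error passes through [psi]
   unchanged. *)
have -> : w - psi (w - v) + beta * e =
    (w + beta * e) - psi ((w + beta * e) - (v + beta * e)).
  have -> : w + beta * e - (v + beta * e) = w - v by ring.
  by rewrite addrAC.
by apply: loss_gain_le => //; [rewrite lerD2r | apply: hq1; lra].
Qed.

(** The difference of the two discounted continuation means is exactly [win_gain f q], which pairs
    with its own [psi]. *)
Lemma bellman_increment f q : admissible f -> 0 <= q ->
  bellman f q - bellman f (pos_part (q - 1)) =
  (c q - c (pos_part (q - 1))) + (win_gain f q - psi (win_gain f q))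
  + psi (win_gain f (pos_part (q - 1))).
Proof.
move=> af q0; rewrite /bellman {3}/win_gain (pos_part_id q0).
rewrite (pos_part_id (pos_part_ge0 (q - 1))).
move: (psi (win_gain f q)) (psi _) (W f q) (W f _) => u v w z; ring.
Qed.

Lemma adm_bellman f : admissible f -> admissible (bellman f).
Proof.
move=> af; split.
- move=> q; apply: cvgB.
    apply: cvgD; first exact: (adm_continuous c_admissible).
    apply: cvgM; first exact: cvg_cst.
    apply: continuous_comp; first exact: continuous_pos_part.
    exact: (continuous_arrival_mean (adm_continuous af)).
  apply: continuous_comp; first exact: continuous_win_gain.
  exact: continuous_psi.
- move=> q; rewrite bellmanE addr_ge0//; first exact: (adm_ge0 c_admissible).
  have mon : beta * W f (pos_part (q - 1)) <= beta * W f (pos_part q).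
    rewrite ler_pM2l//.
    by apply: arrival_mean_nondecreasing => //; apply: pos_part_nondecreasing; lra.
  have v0 : 0 <= beta * W f (pos_part (q - 1)) by rewrite mulr_ge0//; apply: arrival_mean_ge0; exact: adm_ge0.
  (* Compare with zero continuation costs, whose net value is [0 - psi 0 = 0]. *)
  have := @loss_gain_le 0 0 _ _ (lexx _) mon (le_trans v0 mon) v0.
  by rewrite subrr psi_le0// subr0.
- move=> x y xy; rewrite !bellmanE; apply: lerD.
    exact: (adm_nondecreasing c_admissible).
  by apply: loss_gain_le; rewrite ler_pM2l//;
    apply: arrival_mean_nondecreasing => //; apply: pos_part_nondecreasing; lra.
- move=> x y x0 xy; have y0 := le_trans x0 xy.
  rewrite [leLHS](bellman_increment af x0) [leRHS](bellman_increment af y0).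
  have h1 := win_gain_le af x0 xy.
  have h2 := win_gain_le af (pos_part_ge0 (x - 1))
    (pos_part_nondecreasing (_ : x - 1 <= y - 1)).
  have {}h2 : win_gain f (pos_part (x - 1)) <= win_gain f (pos_part (y - 1)).
    by apply: h2; lra.
  (* The three terms of [bellman_increment] grow separately; the middle one because [z - psi z] is
     nondecreasing. *)
  have := adm_increment c_admissible x0 xy.
  have := psi_subr_le p_continuous p_nondecreasing p_range h1.
  have := psi_nondecreasing p_continuous p_nondecreasing p_range h2.
  move: (psi _) (psi _) (psi _) (psi _) => u v w z; lra.
Qed.

(** The right-hand side is [c q + beta * W f q] plus the payment minus [p x] times the gain, and
    [payment_ge] bounds the latter difference below. *)
Lemma bellman_le_bid f q x : admissible f -> 0 <= q -> 0 <= x ->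
  bellman f q <= c q + (x * p x - psi x)
    + beta * (p x * W f (pos_part (q - 1)) + (1 - p x) * W f q).
Proof.
move=> af q0 x0.
have := payment_ge p_continuous p_nondecreasing (win_gain_ge0 q af) x0.
rewrite /bellman {1}/win_gain (pos_part_id q0).
move: (psi (win_gain f q)) (psi x) (W f q) (W f _) => u v w z h.
by rewrite -subr_ge0; move: h; rewrite -subr_ge0; congr (0 <= _); ring.
Qed.

(** At the bid [x = win_gain f q] the term [x * p x] cancels the expected gain and leaves
    [- psi x]. *)
Lemma bellman_eq_bid f q : admissible f -> 0 <= q ->
  let x := win_gain f q in
  bellman f q = c q + (x * p x - psi x)
    + beta * (p x * W f (pos_part (q - 1)) + (1 - p x) * W f q).
Proof.
move=> af q0 x; rewrite /bellman -/x.
have -> : x * p x = p x * (beta * (W f q - W f (pos_part (q - 1)))).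
  by rewrite mulrC /x {2}/win_gain (pos_part_id q0).
rewrite (pos_part_id q0).
by move: (psi x) (p x) (W f q) (W f _) => u v w z; ring.
Qed.

(** * Value iteration and its limit *)

Definition value_iter (k : nat) : R -> R := iter k bellman (fun=> 0).

Lemma adm_value_iter k : admissible (value_iter k).
Proof. by elim: k => [|k IH]; [exact: adm_cst0|exact: adm_bellman]. Qed.

Lemma value_iterS k q : value_iter k q <= value_iter k.+1 q.
Proof.
elim: k q => [|k IH] q; first exact: (adm_ge0 (adm_value_iter 1)).
apply: (bellman_le q (adm_value_iter k) (adm_value_iter k.+1)) => x _.
exact: IH.
Qed.

(** In [k] steps the queue grows by at most [k * Abar], so lengthening the horizon by one step adds
    at most the discounted holding cost there. *)
Lemma value_iterS_le k q :
  value_iter k.+1 q <= value_iter k q + beta ^+ k * c (pos_part q + k%:R * Abar).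
Proof.
elim: k q => [|k IH] q.
  rewrite [value_iter 1 q]bellmanE /= expr0 mul1r mul0r addr0 add0r.
  have W0 x : W (fun=> 0) x = 0 by exact: arrival_mean_cst0.
  rewrite !W0 !mulr0 subrr psi_le0// subr0 addr0.
  by apply: (adm_nondecreasing c_admissible); rewrite /pos_part le_max lexx.
rewrite exprS -mulrA.
apply: (bellman_leD (adm_value_iter k) (adm_value_iter k.+1)).
move=> x /andP[x0 xq]; apply: (le_trans (IH x)); rewrite lerD2l.
apply: ler_wpM2l; first exact: exprn_ge0.
apply: (adm_nondecreasing c_admissible); rewrite (pos_part_id x0).
by rewrite -natr1 mulrDl mul1r; lra.
Qed.

(** The form in which polynomial growth of the cost is used: discounting beats linear growth of the
    queue, uniformly for [q <= B]. *)
Hypothesis c_growth : forall B : R, exists K gamma : R,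
  [/\ 0 <= K, 0 <= gamma < 1 &
      forall k q, q <= B -> beta ^+ k * c (pos_part q + k%:R * Abar) <= K * gamma ^+ k].

Lemma value_iter_nondecreasing q :
  {homo (fun k => value_iter k q) : n m / (n <= m)%N >-> n <= m}.
Proof. by apply: homo_leq => [//|y x z|k]; [exact: le_trans|exact: value_iterS]. Qed.

Lemma value_iter_cauchy B : exists2 e : nat -> R, e @ \oo --> (0 : R) &
  forall q, q <= B -> forall n m, value_iter m q <= value_iter n q + e n.
Proof.
have [K [gamma [K0 /andP[g0 g1] HK]]] := c_growth B.
have g1' : 0 < 1 - gamma by rewrite subr_gt0.
(* The tail of the geometric series with terms [K * gamma ^+ k]. *)
exists (fun n => K / (1 - gamma) * gamma ^+ n).
  rewrite -[X in _ --> X](mulr0 (K / (1 - gamma))); apply: cvgM; first exact: cvg_cst.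
  by apply: cvg_expr; rewrite ger0_norm.
move=> q qB n m.
have step j : value_iter (n + j) q <=
    value_iter n q + K / (1 - gamma) * (gamma ^+ n - gamma ^+ (n + j)).
  elim: j => [|j IH]; first by rewrite addn0 subrr mulr0 addr0.
  rewrite addnS; apply: (le_trans (value_iterS_le _ q)).
  apply: (le_trans (lerD IH (HK (n + j)%N q qB))).
  rewrite -addrA lerD2l exprS.
  have -> : K * gamma ^+ (n + j) = K / (1 - gamma) * (gamma ^+ (n + j) * (1 - gamma)).
    by field; rewrite gt_eqF.
  by rewrite -mulrDr; apply: ler_wpM2l; [rewrite divr_ge0// ltW|lra].
have nn : value_iter m q <= value_iter (n + m) q.
  by apply: value_iter_nondecreasing; exact: leq_addl.
apply: (le_trans nn); apply: (le_trans (step m)); rewrite lerD2l.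
by apply: ler_wpM2l; [rewrite divr_ge0// ltW|rewrite gerBl exprn_ge0].
Qed.

Definition value_lim (q : R) : R := limn (fun k => value_iter k q).

Lemma cvg_value_iter q : (fun k => value_iter k q) @ \oo --> value_lim q.
Proof.
have [e e0 He] := value_iter_cauchy q.
apply: (@nondecreasing_is_cvgn R _ (@value_iter_nondecreasing q)).
by exists (value_iter 0 q + e 0%N) => _ [m _ <-]; exact: He.
Qed.

Lemma value_iter_le_lim k q : value_iter k q <= value_lim q.
Proof.
apply: (nondecreasing_cvgn_le (@value_iter_nondecreasing q)).
by apply/cvg_ex; exists (value_lim q); exact: cvg_value_iter.
Qed.

Lemma value_lim_le B : exists2 e : nat -> R, e @ \oo --> (0 : R) &
  forall q, q <= B -> forall n, value_lim q <= value_iter n q + e n.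
Proof.
have [e e0 He] := value_iter_cauchy B; exists e => // q qB n.
apply: (ler_cvg_to (@cvg_value_iter q) (cvg_cst (value_iter n q + e n))).
by apply: nearW => m; exact: He.
Qed.

Lemma continuous_value_lim : continuous value_lim.
Proof.
(* The bound [q + 1] covers a neighbourhood of [q]. As the iterates approach the limit from below,
   two halves of [eps] suffice: one for the tail, one for continuity of an iterate. *)
move=> q; have [e e0 He] := value_lim_le (q + 1).
apply/cvgrPdist_le => /= eps eps0.
have [n en] : exists n, `|e n| <= eps / 2.
  have /cvgrPdist_le/(_ (eps / 2)) : e @ \oo --> (0 : R) by [].
  rewrite divr_gt0// => /(_ isT)[n _ /(_ n (leqnn n))] /=.
  by rewrite sub0r normrN => h; exists n.
near=> y.
have yq : y <= q + 1.
  have : `|q - y| <= 1 by near: y; apply: cvgr_dist_le.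
  by rewrite ler_norml => /andP[]; lra.
have : `|value_iter n q - value_iter n y| <= eps / 2.
  near: y; apply: cvgr_dist_le; last by rewrite divr_gt0.
  exact: (adm_continuous (adm_value_iter n)).
have := value_iter_le_lim n q; have := value_iter_le_lim n y.
have := He y yq n; have := He q (_ : q <= q + 1) n => /(_ _).
rewrite lerDl ler01 => /(_ isT).
move: en; rewrite !ler_norml.
move: (value_iter n q) (value_iter n y) (value_lim q) (value_lim y) (e n) => a b a' b' en.
lra.
Unshelve. all: by end_near. Qed.

Lemma adm_value_lim : admissible value_lim.
Proof.
split.
- exact: continuous_value_lim.
- by move=> q; exact: (value_iter_le_lim 0).
- move=> x y xy; apply: (ler_cvg_to (@cvg_value_iter x) (@cvg_value_iter y)).
  by apply: nearW => k; exact: (adm_nondecreasing (adm_value_iter k)).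
- move=> x y x0 xy.
  apply: (ler_cvg_to (cvgB (@cvg_value_iter x) (@cvg_value_iter _))
                     (cvgB (@cvg_value_iter y) (@cvg_value_iter _))).
  by apply: nearW => k; exact: (adm_increment (adm_value_iter k)).
Qed.

(** Squeeze: [bellman value_lim q] is at least every iterate at [q], and at most iterate [k.+1] plus
    [beta * e k], with [e] uniform over the states reachable in one step. *)
Lemma bellman_value_lim q : bellman value_lim q = value_lim q.
Proof.
have [e e0 He] := value_lim_le (pos_part q + Abar).
have cS : (fun k => value_iter k.+1 q) @ \oo --> value_lim q.
  by have := @cvg_value_iter q; rewrite -(cvg_shiftS (fun k => value_iter k q)).
apply/eqP; rewrite eq_le; apply/andP; split; last first.
  apply: (ler_cvg_to cS (cvg_cst _)); apply: nearW => k.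
  by apply: (bellman_le q (adm_value_iter k) adm_value_lim) => x _; exact: value_iter_le_lim.
have ce : (fun k => value_iter k.+1 q + beta * e k) @ \oo --> value_lim q.
  rewrite -[X in _ --> X]addr0 -(mulr0 beta); apply: cvgD => //.
  by apply: cvgM => //; exact: cvg_cst.
apply: (ler_cvg_to (cvg_cst _) ce); apply: nearW => k.
apply: (bellman_leD (adm_value_iter k) adm_value_lim) => x /andP[x0 xq].
exact: He.
Qed.

Hypothesis c_increasing : forall x y, 0 <= x -> x < y -> c x < c y.
Hypothesis c_increment_increasing : forall x y, 0 <= x -> x < y ->
  c x - c (pos_part (x - 1)) < c y - c (pos_part (y - 1)).

(** Rewriting the limit as its own Bellman image exposes [c]; its strict monotonicity and strictly
    growing increments pass to the limit, since the remaining terms are nondecreasing. *)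
Lemma win_gain_value_lim_increasing x y : 0 <= x -> x < y ->
  win_gain value_lim x < win_gain value_lim y.
Proof.
have aV := adm_value_lim.
apply: win_gain_lt => [|{}x {}y x0 xy|{}x {}y x0 xy]; first exact: continuous_value_lim.
- have cxy := c_increasing x0 xy; have xy' := ltW xy.
  rewrite -(bellman_value_lim x) -(bellman_value_lim y) !bellmanE.
  apply: (ltr_leD cxy).
  by apply: loss_gain_le; rewrite ler_pM2l//;
    apply: arrival_mean_nondecreasing => //; apply: pos_part_nondecreasing; lra.
- have xy' := ltW xy; have y0 := le_trans x0 xy'.
  rewrite -(bellman_value_lim x) -(bellman_value_lim y).
  rewrite -(bellman_value_lim (pos_part (x - 1))) -(bellman_value_lim (pos_part (y - 1))).
  rewrite [ltLHS](bellman_increment aV x0) [ltRHS](bellman_increment aV y0).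
  have h1 := win_gain_le aV x0 xy'.
  have xy1 : x - 1 <= y - 1 by lra.
  have h2 := win_gain_le aV (pos_part_ge0 (x - 1)) (pos_part_nondecreasing xy1).
  have := c_increment_increasing x0 xy.
  have := psi_subr_le p_continuous p_nondecreasing p_range h1.
  have := psi_nondecreasing p_continuous p_nondecreasing p_range h2.
  move: (psi _) (psi _) (psi _) (psi _) => u v w z; lra.
Qed.

End Bellman.

(** * Joint laws of independent variables *)

Section PairLaw.
Context d (Omega : measurableType d) (R : realType) (P : probability Omega R).

Definition rv_of (X : Omega -> R) (mX : measurable_fun setT X) : {RV P >-> R} :=
  mfun_Sub (mem_set mX).

(** Rectangles form a generating pi-system, so factorization extends to all measurable sets of
    pairs. The event [F] will be a cylinder of other inputs, whose independence must survive a
    step. *)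
Lemma pair_law (X Y : Omega -> R) (mX : measurable_fun setT X)
    (mY : measurable_fun setT Y) (F : set Omega) (mF : measurable F) :
  (forall A B : set R, measurable A -> measurable B ->
    P (X @^-1` A `&` Y @^-1` B `&` F) = (P (X @^-1` A) * P (Y @^-1` B) * P F)%E) ->
  forall S : set (R * R), measurable S ->
    P ((fun w => (X w, Y w)) @^-1` S `&` F)
    = ((distribution P (rv_of mX) \x distribution P (rv_of mY)) S * P F)%E.
Proof.
move=> XY S mS.
have mXY : measurable_fun setT (fun w => (X w, Y w)) by exact: measurable_fun_pair.
(* With [F] fixed, both sides are finite measures in [S]: the pushforward of [P] restricted to [F],
   and the product law scaled by [P F]. *)
pose m1 : {measure set (R * R) -> \bar R} :=
  measure_function_pushforward__canonical__measure_function_Measure (mrestr P mF) mXY.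
have PFfin : P F \is a fin_num by exact: fin_num_measure.
have PF0 : (0 <= fine (P F))%R by exact: fine_ge0.
pose m2 : {measure set (R * R) -> \bar R} :=
  mscale (NngNum PF0) (distribution P (rv_of mX) \x distribution P (rv_of mY))%E.
pose C : set (set (R * R)) := [set A `*` B | A in measurable & B in measurable].
suff : m1 S = m2 S.
  by rewrite /m1 /m2 /= /pushforward /mrestr /mscale /= fineK// muleC.
apply: (@measure_unique _ _ _ C (fun=> setT)) => //.
- exact: measurable_prod_measurableType.
- move=> _ _ [A mA [B mB <-]] [A' mA' [B' mB' <-]]; rewrite -setXI.
  by exists (A `&` A'); [exact: measurableI|exists (B `&` B') => //; exact: measurableI].
- by move=> _; exists setT => //; exists setT => //; rewrite setXTT.
- by rewrite bigcup_const.
- move=> _ [A mA [B mB <-]].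
  rewrite /m1 /m2 /= /pushforward /mrestr /mscale /= fineK//.
  rewrite product_measure1E// /distribution /pushforward /= muleC -XY//.
- by move=> _; rewrite /m1/= /pushforward /mrestr/=; apply: (le_lt_trans (probability_le1 _ _)); rewrite ?ltry//;
   rewrite preimage_setT setTI.
Qed.

(** Conditioning on [X] in Tonelli form: [Y] is integrated against its own law while [X] is
    frozen. *)
Lemma integral_pair_law (X Y : Omega -> R) (mX : measurable_fun setT X)
    (mY : measurable_fun setT Y) (g : R * R -> \bar R) :
  (forall A B : set R, measurable A -> measurable B ->
    P (X @^-1` A `&` Y @^-1` B) = (P (X @^-1` A) * P (Y @^-1` B))%E) ->
  measurable_fun setT g -> (forall z, 0 <= g z)%E ->
  (\int[P]_w g (X w, Y w) =
   \int[P]_w \int[distribution P (rv_of mY)]_y g (X w, y))%E.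
Proof.
move=> XY mg g0.
have mXY : measurable_fun setT (fun w => (X w, Y w)) by exact: measurable_fun_pair.
transitivity (\int[pushforward P (fun w => (X w, Y w))]_z g z)%E.
  by rewrite (ge0_integral_pushforward mXY).
transitivity (\int[distribution P (rv_of mX) \x distribution P (rv_of mY)]_z g z)%E.
  apply: eq_measure_integral => S mS _.
  rewrite /pushforward -[X in P X = _]setIT (pair_law mX mY measurableT)//.
    by rewrite probability_setT mule1.
  by move=> A B mA mB; rewrite setIT probability_setT mule1; exact: XY.
rewrite fubini_tonelli1//.
rewrite (ge0_integral_distribution (rv_of mX))//.
  exact: measurable_fun_fubini_tonelli_F.
by move=> x; apply: integral_ge0.
Qed.

End PairLaw.

(** * Independence of the state from inputs not yet used *)

Section Freshness.
Context d (Omega : measurableType d) (R : realType) (P : probability Omega R).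
Context (I : choiceType) (Z : I -> Omega -> R).
Hypothesis mZ : forall i, measurable_fun setT (Z i).
Implicit Types (X : Omega -> R) (J : pred I).

Let cyl (s : seq I) (B : I -> set R) : set Omega := \bigcap_(i in [set` s]) (Z i @^-1` B i).

(** Joint independence tested on finite cylinders; taking [A = setT] recovers mutual independence of
    the inputs in [J]. *)
Definition independent_of X J := forall (A : set R) (s : seq I) (B : I -> set R),
  measurable A -> uniq s -> all J s -> (forall i, measurable (B i)) ->
  P (X @^-1` A `&` \bigcap_(i in [set` s]) (Z i @^-1` B i))
  = (P (X @^-1` A) * \prod_(i <- s) P (Z i @^-1` B i))%E.

Lemma measurable_preimage_setT X (A : set R) :
  measurable_fun setT X -> measurable A -> measurable (X @^-1` A).
Proof. by move=> mX mA; rewrite -[X in measurable X]setTI; exact: mX. Qed.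

Lemma measurable_cylinder s (B : I -> set R) : (forall i, measurable (B i)) ->
  measurable (cyl s B).
Proof.
move=> mB; apply: fin_bigcap_measurable; first exact: finite_seq.
by move=> i _; exact: measurable_preimage_setT.
Qed.

Lemma independent_of_cst (q : R) : mutually_independent P Z ->
  independent_of (fun=> q) predT.
Proof.
move=> mi A s B mA us _ mB; have [qA|qA] := pselect (A q).
  by rewrite (_ : _ @^-1` A = setT) ?setTI ?probability_setT ?mul1e; [exact: mi|apply/seteqP; split].
by rewrite (_ : _ @^-1` A = set0) ?set0I ?measure0 ?mul0e//; apply/seteqP; split.
Qed.

Lemma independent_of_sub X J J' : {subset J' <= J} ->
  independent_of X J -> independent_of X J'.
Proof.
by move=> J'J XJ A s B mA us /allP Js mB; apply: XJ => //; apply/allP => i /Js; exact: J'J.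
Qed.

Lemma independent_of1 X J i (A B : set R) : independent_of X J -> J i ->
  measurable A -> measurable B ->
  P (X @^-1` A `&` Z i @^-1` B) = (P (X @^-1` A) * P (Z i @^-1` B))%E.
Proof.
move=> XJ Ji mA mB; have := XJ A [:: i] (fun=> B) mA isT.
rewrite /= Ji => /(_ isT (fun=> mB)); rewrite big_seq1 => <-.
by congr (P (_ `&` _)); rewrite set_cons1 bigcap_set1.
Qed.

(** Consuming the fresh input [i] removes only [i] from the fresh set: the pair of [X] and [Z i] is
    jointly independent of every cylinder avoiding [i], hence so is any function of that pair. *)
Lemma independent_of_step X J i (g : R * R -> R) : measurable_fun setT X ->
  measurable_fun setT g -> independent_of X J -> J i ->
  independent_of (fun w => g (X w, Z i w)) [pred j | J j & j != i].
Proof.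
move=> mX mg XJ Ji A s B mA us /allP Js mB.
have PF : P (cyl s B) = (\prod_(j <- s) P (Z j @^-1` B j))%E.
  have := XJ setT s B measurableT us; rewrite preimage_setT setTI probability_setT mul1e.
  by apply => //; apply/allP => j /Js /andP[].
have si : i \notin s by apply/negP => /Js /=; rewrite eqxx andbF.
have XY (C D : set R) : measurable C -> measurable D ->
    P (X @^-1` C `&` Z i @^-1` D `&` cyl s B) =
    (P (X @^-1` C) * P (Z i @^-1` D) * P (cyl s B))%E.
  (* Put the condition on [Z i] into a cylinder over [i :: s], where the hypothesis on [X]
     applies. *)
  move=> mC mD; pose B' j := if j == i then D else B j.
  have mB' j : measurable (B' j) by rewrite /B'; case: ifP.
  have := XJ C (i :: s) B' mC; rewrite /= si us Ji /= => /(_ isT).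
  have -> : all J s by apply/allP => j /Js /andP[].
  have -> : [set` i :: s] = i |` [set` s].
    by apply/seteqP; split=> x /=; rewrite inE => /predU1P.
  move=> /(_ isT mB'); rewrite bigcap_setU1 big_cons {1 3}/B' eqxx setIA.
  have js j : j \in s -> B' j = B j.
    by move=> jS; rewrite /B'; case: eqP => // ji; rewrite -ji jS in si.
  rewrite (@eq_bigcapr _ _ _ _ (fun j => Z j @^-1` B j)); last by move=> j /js ->.
  rewrite -/(cyl s B) => ->; rewrite -muleA PF; congr (_ * (_ * _))%E.
  by rewrite big_seq [RHS]big_seq; apply: eq_bigr => j /js ->.
have mS : measurable (g @^-1` A) by rewrite -[X in measurable X]setTI; exact: mg.
rewrite -PF -/(cyl s B).
have := pair_law mX (mZ i) (measurable_cylinder s mB) XY mS.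
have := pair_law (P := P) mX (mZ i) measurableT _ mS.
rewrite setIT probability_setT mule1 => law.
rewrite law => [->//|C D mC mD].
by rewrite setIT mule1; exact: independent_of1 XJ Ji mC mD.
Qed.

End Freshness.

(** * Integration against the laws of the inputs *)

Section ArrivalLaws.
Context {R : realType}.

Lemma integral_law_uniform (mu : probability R R) (x a b : R) :
  (forall B : set R, measurable B -> mu B = uniform_prob (@ltr01 R) B) ->
  0 <= x <= 1 -> 0 <= a -> 0 <= b ->
  (\int[mu]_u (if u < x then a else b)%:E = (x * a + (1 - x) * b)%:E)%E.
Proof.
move=> muU /andP[x0 x1] a0 b0.
(* The event [u < x] realizes a win of probability [x]; the range of [x] makes its trace on the unit
   interval [[0, x[]. *)
have mux : mu `]-oo, x[%classic = x%:E.
  rewrite muU// /uniform_prob integral_uniform_pdf.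
  have -> : `]-oo, x[%classic `&` `[0, 1]%classic = `[0, x[%classic :> set R.
    apply/seteqP; split=> u /=; rewrite !in_itv/=.
      by move=> [-> /andP[-> _]].
    by move=> /andP[-> ux]; split=> //=; rewrite (ltW (lt_le_trans ux x1)).
  rewrite (eq_integral (fun=> 1%E)); last first.
    move=> u; rewrite inE/= in_itv/= => /andP[u0 ux].
    by rewrite /uniform_pdf u0 (ltW (lt_le_trans ux x1)) subr0 invr1.
  rewrite integral_cst//= mul1e lebesgue_measure_itv/= lte_fin.
  by case: ltP => [_|xle0]; [rewrite oppr0 adde0|congr EFin; lra].
have mux' : mu `[x, +oo[%classic = (1 - x)%:E.
  by rewrite -setCitvl probability_setC// mux.
have setTE : [set: R] = `]-oo, x[%classic `|` `[x, +oo[%classic.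
  by rewrite -(setCitvl (BLeft x)) setUv.
rewrite setTE ge0_integral_setU//=.
- rewrite (eq_integral (fun=> a%:E)); last first.
    by move=> u; rewrite inE/= in_itv/= => ->.
  rewrite [X in (_ + X)%E](eq_integral (fun=> b%:E)); last first.
    by move=> u; rewrite inE/= in_itv/= andbT ltNge => ->.
  by rewrite !integral_cst//= mux mux' -!EFinM -EFinD (mulrC a) (mulrC b).
- apply/measurable_EFinP; apply: measurable_funTS; apply: measurable_fun_ifT => //.
  by apply: measurable_fun_ltr => //; exact: measurable_cst.
- by move=> u _; rewrite lee_fin; case: ifP.
- by rewrite -(setCitvl (BLeft x)); apply/disj_setPS; rewrite setICr.
Qed.

(** The complement of [[0, Abar]] is null, so the extended integral over the line is the finite real
    mean. *)
Lemma integral_law_arrival (mu Phi : probability R R) (Abar x : R) (f : R -> R) :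
  (forall B : set R, measurable B -> mu B = Phi B) -> distribution_on Phi 0 Abar ->
  continuous f -> (forall y, 0 <= f y) ->
  (\int[mu]_a (f (x + a))%:E = (arrival_mean Phi Abar f x)%:E)%E.
Proof.
move=> muE Phi_supp fc f0.
have mf : measurable_fun setT (fun a => (f (x + a))%:E).
  by apply/measurable_EFinP; apply: continuous_measurable_fun; exact: continuous_shift.
rewrite (eq_measure_integral Phi); last by move=> B mB _; exact: muE.
have setTE : [set: R] = `[0, Abar]%classic `|` ~` `[0, Abar]%classic by rewrite setUv.
rewrite [in LHS]setTE ge0_integral_setU//=; last 4 first.
- exact: measurableC.
- exact: measurable_funTS.
- by move=> u _; rewrite lee_fin.
- by apply/disj_setPS; rewrite setICr.
rewrite [X in (_ + X)%E]null_set_integral ?adde0; last 3 first.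
- exact: measurableC.
- exact: measurable_funTS.
- by have := probability_setC Phi (measurable_itv `[0, Abar]); rewrite Phi_supp subee.
rewrite /arrival_mean /Rintegral fineK//.
exact: integrable_fin_num (arrival_integrable Phi Abar x fc).
Qed.

End ArrivalLaws.

(** * Cost of the queue and verification of the value function *)

Section QueueCost.
Context d (Omega : measurableType d) (R : realType) (P : probability Omega R).
Context (A U : nat -> {RV P >-> R}) (Phi : probability R R).
Context (M : nat) (beta Abar : R) (C rho : R -> R).
Hypothesis inputs : queue_inputs Phi A U.
Hypothesis Phi_supp : distribution_on Phi 0 Abar.
Hypothesis beta_range : 0 < beta < 1.

Local Notation p := (win_prob M rho).
Local Notation psi := (psi p).
Local Notation c := (fun x => C (pos_part x)).
Local Notation W := (arrival_mean Phi Abar).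
Local Notation bellman := (bellman p c Phi Abar beta).
Local Notation win_gain := (win_gain Phi Abar beta).
Local Notation value_iter := (value_iter p c Phi Abar beta).
Local Notation value_lim := (value_lim p c Phi Abar beta).

Hypothesis p_continuous : continuous p.
Hypothesis p_nondecreasing : forall x y, x <= y -> p x <= p y.
Hypothesis p_range : forall x, 0 <= p x <= 1.
Hypothesis c_admissible : admissible c.

Let beta_gt0 : 0 < beta. Proof. by case/andP: beta_range. Qed.
Let beta_ge0 : 0 <= beta. Proof. exact: ltW. Qed.

(** * The queue under a fixed policy *)

Section Policy.
Context (theta : R -> R) (q : R).
Hypothesis theta_policy : bid_policy theta.
Hypothesis q_ge0 : 0 <= q.

Local Notation Q := (queue A U M rho theta q).

Lemma queue_ge0 t w : 0 <= Q t w.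
Proof.
have [A0 _ _ _] := inputs.
elim: t => [//|t IH] /=; apply: addr_ge0; last exact: A0.
by case: ifP => _ //; exact: pos_part_ge0.
Qed.

(* Agrees with [theta] along the queue, and is measurable on the whole line. *)
Let theta' (x : R) : R := theta (pos_part x).

Lemma measurable_policy_ext : measurable_fun setT theta'.
Proof.
have [mtheta _] := theta_policy.
apply: (measurable_comp (measurable_itv `[0, +oo[)) mtheta _.
- by move=> _ [x _ <-] /=; rewrite in_itv/= andbT pos_part_ge0.
- exact: continuous_measurable_fun continuous_pos_part.
Qed.

(** The state after the auction and before the arrival; each half-step then consumes a single
    input. *)
Let serve (z : R * R) : R := if z.2 < p (theta' z.1) then pos_part (z.1 - 1) else z.1.

Let measurable_serve : measurable_fun setT serve.
Proof.
apply: measurable_fun_ifT.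
- apply: measurable_fun_ltr; first exact: measurable_snd.
  apply: measurableT_comp; first exact: continuous_measurable_fun.
  by apply: measurableT_comp; [exact: measurable_policy_ext|exact: measurable_fst].
- rewrite (_ : (fun _ => _) = (fun x => pos_part (x - 1)) \o fst)//.
  apply: measurableT_comp; last exact: measurable_fst.
  exact: continuous_measurable_fun continuous_pos_part_subr1.
- exact: measurable_fst.
Qed.

Let served t w := serve (Q t w, U t w).

Lemma queueS t w : Q t.+1 w = served t w + A t w.
Proof. by rewrite /served /serve /theta' /= (pos_part_id (queue_ge0 t w)). Qed.

Lemma measurable_queue t : measurable_fun setT (Q t).
Proof.
elim: t => [|t IH]; first exact: measurable_cst.
rewrite (_ : Q t.+1 = served t \+ A t); last by apply/funext => w; exact: queueS.
apply: measurable_funD; last exact: measurable_funP.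
apply: measurableT_comp; first exact: measurable_serve.
by apply: measurable_fun_pair => //; exact: measurable_funP.
Qed.

Let Z (i : nat + nat) : Omega -> R :=
  match i with inl t => A t : Omega -> R | inr t => U t : Omega -> R end.

Let mZ i : measurable_fun setT (Z i).
Proof. by case: i => t; exact: measurable_funP. Qed.

Let fresh t : pred (nat + nat) := fun i => (t <= match i with inl s => s | inr s => s end)%N.

Let measurable_served t : measurable_fun setT (served t).
Proof.
apply: measurableT_comp; first exact: measurable_serve.
by apply: measurable_fun_pair; [exact: measurable_queue|exact: measurable_funP].
Qed.

Lemma independent_served t : independent_of P Z (Q t) (fresh t) ->
  independent_of P Z (served t) [pred j | fresh t j & j != inr t].
Proof.
move=> h; apply: (independent_of_step mZ (i := inr t) (measurable_queue t) measurable_serve h).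
exact: leqnn.
Qed.

(** Step [t] consumes first [U t], then [A t]; the inputs with index above [t] avoid both. *)
Lemma independent_queue t : independent_of P Z (Q t) (fresh t).
Proof.
elim: t => [|t /independent_served IH].
  apply: (@independent_of_sub _ _ _ _ _ _ _ predT) => //.
  by apply: independent_of_cst; have [_ _ _] := inputs.
have mD : measurable_fun setT (fun z : R * R => z.1 + z.2).
  by apply: measurable_funD; [exact: measurable_fst|exact: measurable_snd].
have := independent_of_step mZ (i := inl t) (measurable_served t) mD IH.
rewrite /= /fresh leqnn => /(_ isT); rewrite (_ : (fun w => _) = Q t.+1); last first.
  by apply/funext => w; rewrite queueS.
apply: independent_of_sub => -[s|s] ts; rewrite !inE /=; have {}ts : (t < s)%N := ts.
  by rewrite (ltnW ts)/=; apply/eqP => -[st]; rewrite st ltnn in ts.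
by rewrite (ltnW ts)/= andbT; apply/eqP => -[st]; rewrite st ltnn in ts.
Qed.

(** The conditional mean of [f] at the next state, given the current state [x]. *)
Definition next_mean (f : R -> R) (x : R) : R :=
  p (theta' x) * W f (pos_part (x - 1)) + (1 - p (theta' x)) * W f x.

Lemma measurable_next_mean f : admissible f -> measurable_fun setT (next_mean f).
Proof.
move=> af; have Wc := continuous_arrival_mean (adm_continuous af).
have mp : measurable_fun setT (fun x => p (theta' x)).
  by apply: measurableT_comp; [exact: continuous_measurable_fun|exact: measurable_policy_ext].
apply: measurable_funD; apply: measurable_funM => //.
- apply: measurableT_comp; first exact: (continuous_measurable_fun (Wc Phi Abar)).
  exact: continuous_measurable_fun continuous_pos_part_subr1.
- by apply: measurable_funB => //; exact: measurable_cst.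
- exact: (continuous_measurable_fun (Wc Phi Abar)).
Qed.

Lemma next_mean_ge0 f x : admissible f -> 0 <= next_mean f x.
Proof.
move=> af; have /andP[p0 p1] := p_range (theta' x).
by apply: addr_ge0; apply: mulr_ge0; rewrite ?subr_ge0//; apply: arrival_mean_ge0;
  exact: adm_ge0.
Qed.

(** Integrate out the arrival with the served state frozen, then the auction variable with the queue
    frozen. *)
Lemma integral_queueS f t : admissible f ->
  (\int[P]_w (f (Q t.+1 w))%:E = \int[P]_w (next_mean f (Q t w))%:E)%E.
Proof.
move=> af; have [_ A_law U_law _] := inputs.
have fc := adm_continuous af.
have mf := continuous_measurable_fun fc.
have mWf := continuous_measurable_fun (@continuous_arrival_mean _ Phi Abar _ fc).
have iQ := @independent_queue t; have iY := independent_served iQ.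
under eq_integral do rewrite queueS.
have mg1 : measurable_fun setT (fun z : R * R => (f (z.1 + z.2))%:E).
  apply/measurable_EFinP; apply: measurableT_comp; first exact: mf.
  by apply: measurable_funD; [exact: measurable_fst|exact: measurable_snd].
rewrite (integral_pair_law (measurable_served t) (mZ (inl t)) _ mg1)/=; last 2 first.
- move=> B D mB mD; apply: (independent_of1 (i := inl t) iY _ mB mD).
  by rewrite /= /fresh leqnn.
- by move=> z; rewrite lee_fin adm_ge0.
under eq_integral => w _.
  rewrite (integral_law_arrival _ (A_law t) Phi_supp fc (adm_ge0 af)).
  over.
rewrite /served.
have mg2 : measurable_fun setT (fun z : R * R => (W f (serve z))%:E).
  by apply/measurable_EFinP; apply: measurableT_comp; first exact: mWf.
rewrite (integral_pair_law (measurable_queue t) (mZ (inr t)) _ mg2)/=; last 2 first.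
- by move=> B D mB mD; apply: (independent_of1 (i := inr t) iQ _ mB mD); exact: leqnn.
- by move=> z; rewrite lee_fin arrival_mean_ge0//; exact: adm_ge0.
apply: eq_integral => w _.
rewrite -(integral_law_uniform (U_law t) (p_range _) (arrival_mean_ge0 Phi Abar _ (adm_ge0 af))
  (arrival_mean_ge0 Phi Abar _ (adm_ge0 af))).
by apply: eq_integral => u _; rewrite /serve /=; case: ifP.
Qed.

Let step_cost t w : R := beta ^+ t * (C (Q t w) + payment M rho (theta (Q t w))).

Lemma payment_psi x : payment M rho x = x * p x - psi x.
Proof. by []. Qed.

Lemma step_cost_ge0 t w : 0 <= step_cost t w.
Proof.
apply: mulr_ge0; first exact: exprn_ge0.
apply: addr_ge0; first by have := adm_ge0 c_admissible (Q t w); rewrite pos_part_id ?queue_ge0.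
rewrite payment_psi; apply: payment_ge0 => //.
by have [_ + ] := theta_policy; apply; exact: queue_ge0.
Qed.

Lemma measurable_step_cost t : measurable_fun setT (step_cost t).
Proof.
have -> : step_cost t =
    (fun x => beta ^+ t * (c x + (theta' x * p (theta' x) - psi (theta' x)))) \o Q t.
  by apply/funext => w /=; rewrite /step_cost /theta' !pos_part_id ?queue_ge0.
apply: measurableT_comp; last exact: measurable_queue.
have mt := measurable_policy_ext.
apply: measurable_funM; first exact: measurable_cst.
apply: measurable_funD; first exact: continuous_measurable_fun (adm_continuous c_admissible).
apply: measurable_funB; last first.
  by apply: measurableT_comp; [apply: continuous_measurable_fun; exact: continuous_psi|].
apply: measurable_funM => //.
by apply: measurableT_comp; first exact: continuous_measurable_fun.
Qed.

Definition expected_cost t : \bar R := (\int[P]_w (step_cost t w)%:E)%E.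
Definition expected_tail (f : R -> R) t : \bar R := (\int[P]_w (beta ^+ t * f (Q t w))%:E)%E.

Lemma discounted_cost_series : discounted_cost A U M beta C rho theta q =
  (\sum_(0 <= t <oo) expected_cost t)%E.
Proof.
rewrite /discounted_cost integral_nneseries//.
- by move=> t; apply/measurable_EFinP; exact: measurable_step_cost.
- by move=> t w _; rewrite lee_fin; exact: step_cost_ge0.
Qed.

Lemma expected_tail0 f : expected_tail f 0 = (f q)%:E.
Proof.
rewrite /expected_tail; under eq_integral do rewrite expr0 mul1r /=.
by rewrite integral_cst//= probability_setT mule1.
Qed.

Lemma expected_tail_ge0 f t : admissible f -> (0 <= expected_tail f t)%E.
Proof.
move=> af; apply: integral_ge0 => w _.
by rewrite lee_fin mulr_ge0 ?exprn_ge0// adm_ge0.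
Qed.

(** Merging both expectations into one integral over the state at time [t] reduces Bellman
    comparisons to pointwise ones. *)
Lemma expected_costD f t : admissible f ->
  (expected_cost t + expected_tail f t.+1 =
   \int[P]_w (step_cost t w + beta ^+ t * (beta * next_mean f (Q t w)))%:E)%E.
Proof.
move=> af.
have mn : measurable_fun setT (fun w => (next_mean f (Q t w))%:E).
  apply/measurable_EFinP; apply: measurableT_comp; first exact: measurable_next_mean.
  exact: measurable_queue.
have mf : measurable_fun setT (fun w => (f (Q t.+1 w))%:E).
  apply/measurable_EFinP; apply: measurableT_comp; last exact: measurable_queue.
  exact: continuous_measurable_fun (adm_continuous af).
have -> : expected_tail f t.+1 = (\int[P]_w (beta ^+ t * (beta * next_mean f (Q t w)))%:E)%E.
  rewrite /expected_tail.
  transitivity ((beta ^+ t.+1)%:E * \int[P]_w (f (Q t.+1 w))%:E)%E.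
    rewrite -ge0_integralZl_EFin ?exprn_ge0//.
    by move=> w _; rewrite lee_fin adm_ge0.
  rewrite integral_queueS// -ge0_integralZl_EFin ?exprn_ge0//.
    by apply: eq_integral => w _; rewrite -EFinM exprSr mulrA.
  by move=> w _; rewrite lee_fin next_mean_ge0.
rewrite -ge0_integralD//.
- by move=> w _; rewrite lee_fin step_cost_ge0.
- by apply/measurable_EFinP; exact: measurable_step_cost.
- by move=> w _; rewrite lee_fin !mulr_ge0 ?exprn_ge0// next_mean_ge0.
- apply/measurable_EFinP; apply: measurable_funM; first exact: measurable_cst.
  apply: measurable_funM; first exact: measurable_cst.
  by apply/measurable_EFinP.
Qed.

Lemma bellman_le_step f t w : admissible f ->
  beta ^+ t * bellman f (Q t w) <= step_cost t w + beta ^+ t * (beta * next_mean f (Q t w)).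
Proof.
move=> af; rewrite -mulrDr; apply: ler_wpM2l; first exact: exprn_ge0.
have Q0 := queue_ge0 t w.
have th0 : 0 <= theta (Q t w) by have [_] := theta_policy; apply.
have := bellman_le_bid c p_continuous p_nondecreasing Phi_supp beta_range af Q0 th0.
by rewrite /next_mean /theta' (pos_part_id Q0) payment_psi.
Qed.

Lemma expected_tail_bellman_le f t : admissible f ->
  (expected_tail (bellman f) t <= expected_cost t + expected_tail f t.+1)%E.
Proof.
move=> af; have ab := adm_bellman p_continuous p_nondecreasing p_range Phi_supp
  beta_range c_admissible af.
rewrite expected_costD//; apply: ge0_le_integral => //.
- by move=> w _; rewrite lee_fin mulr_ge0 ?exprn_ge0// adm_ge0.
- apply/measurable_EFinP; apply: measurable_funM; first exact: measurable_cst.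
  apply: measurableT_comp; last exact: measurable_queue.
  exact: continuous_measurable_fun (adm_continuous ab).
- apply/measurable_EFinP; apply: measurable_funD; first exact: measurable_step_cost.
  apply: measurable_funM; first exact: measurable_cst.
  apply: measurable_funM; first exact: measurable_cst.
  by apply: measurableT_comp; [exact: measurable_next_mean|exact: measurable_queue].
- by move=> w _; rewrite lee_fin; exact: bellman_le_step.
Qed.

(** [value_iter n] bounds below the cost of the first [n] steps, and all later costs are
    nonnegative. *)
Lemma value_iter_le_cost n : ((value_iter n q)%:E <= discounted_cost A U M beta C rho theta q)%E.
Proof.
(* The starting time is general because each Bellman step lowers the horizon and advances the
   time. *)
have H t : (expected_tail (value_iter n) t <= \sum_(t <= s < t + n) expected_cost s)%E.
  elim: n t => [|n IH] t.
    rewrite addn0 big_geq// /expected_tail.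
    by under eq_integral do rewrite /= mulr0; rewrite integral0.
  apply: (le_trans (expected_tail_bellman_le t (adm_value_iter p_continuous p_nondecreasing
    p_range Phi_supp beta_range c_admissible n))).
  rewrite addnS -addSn big_ltn; last by rewrite addSn ltnS leq_addr.
  exact: leeD2l.
rewrite discounted_cost_series -(expected_tail0 (value_iter n)).
apply: (le_trans (H 0%N)); rewrite add0n; apply: nneseries_lim_ge => t _ _.
by apply: integral_ge0 => w _; rewrite lee_fin step_cost_ge0.
Qed.

Lemma discounted_cost_le_fixpoint f : admissible f -> (forall x, bellman f x = f x) ->
  (forall x, 0 <= x -> theta x = win_gain f x) ->
  (discounted_cost A U M beta C rho theta q <= (f q)%:E)%E.
Proof.
move=> af ff thetaE.
have step t : expected_tail f t = (expected_cost t + expected_tail f t.+1)%E.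
  rewrite expected_costD//; apply: eq_integral => w _; congr EFin.
  have Q0 := queue_ge0 t w.
  rewrite -{1}(ff (Q t w)) (bellman_eq_bid p c Phi Abar beta af Q0) -(thetaE _ Q0).
  rewrite /step_cost /next_mean /theta' (pos_part_id Q0) payment_psi.
  by rewrite -mulrDr.
(* Dropping the nonnegative tail bounds every partial sum by [f q]. *)
have partial n : (\sum_(0 <= t < n) expected_cost t + expected_tail f n = (f q)%:E)%E.
  elim: n => [|n <-]; first by rewrite big_geq// add0e expected_tail0.
  by rewrite (step n) big_nat_recr//=; exact/esym/addeA.
rewrite discounted_cost_series; apply: lime_le.
  apply: is_cvg_ereal_nneg_natsum => t _.
  by apply: integral_ge0 => w _; rewrite lee_fin step_cost_ge0.
by apply: nearW => n; rewrite -(partial n) leeDl// expected_tail_ge0.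
Qed.

End Policy.

Hypothesis c_growth : forall B : R, exists K gamma : R,
  [/\ 0 <= K, 0 <= gamma < 1 &
      forall k q, q <= B -> beta ^+ k * c (pos_part q + k%:R * Abar) <= K * gamma ^+ k].

Lemma value_erealE q : 0 <= q -> value_ereal A U M beta C rho q = (value_lim q)%:E.
Proof.
move=> q0.
have aV := adm_value_lim p_continuous p_nondecreasing p_range Phi_supp beta_range
  c_admissible c_growth.
have fV := bellman_value_lim p_continuous p_nondecreasing p_range Phi_supp beta_range
  c_admissible c_growth.
apply/eqP; rewrite eq_le; apply/andP; split.
  have pol : bid_policy (win_gain value_lim).
    split; last by move=> x _; exact: win_gain_ge0.
    apply: measurable_funTS; apply: continuous_measurable_fun.
    exact: continuous_win_gain.
  apply: (le_trans _ (discounted_cost_le_fixpoint pol q0 aV fV (fun _ _ => erefl))).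
  by apply: ereal_inf_lbound; exists (win_gain value_lim).
apply: le_ereal_inf_tmp => _ [theta pol <-].
have le_cost n := value_iter_le_cost pol q0 n.
have cV := cvg_value_iter p_continuous p_nondecreasing p_range Phi_supp beta_range
  c_admissible c_growth.
(* A policy may have infinite cost; minus infinity is excluded by the zeroth iterate, which is 0. *)
case E : (discounted_cost _ _ _ _ _ _ _ _) le_cost => [r| |] le_cost.
- rewrite lee_fin; apply: (ler_cvg_to (cV q) (cvg_cst r)).
  by apply: nearW => n; have := le_cost n; rewrite lee_fin.
- by rewrite leey.
- by have := le_cost 0%N.
Qed.

Lemma valueE q : 0 <= q -> value A U M beta C rho q = value_lim q.
Proof. by move=> q0; rewrite /value value_erealE. Qed.

(** The positive part is inactive because the limit is nondecreasing; [valueE] applies since only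
    nonnegative states are evaluated. *)
Lemma best_bidE q : 0 <= q ->
  best_bid A U M beta C rho Phi Abar q = win_gain value_lim q.
Proof.
move=> q0.
have aV := adm_value_lim p_continuous p_nondecreasing p_range Phi_supp beta_range
  c_admissible c_growth.
rewrite /best_bid (@eq_Rintegral _ _ _ Phi _ (fun a => value_lim (q + a) - value_lim (pos_part (q - 1) + a)));
  last first.
  move=> a; rewrite inE/= in_itv/= => /andP[a0 _].
  by rewrite !valueE// addr_ge0// pos_part_ge0.
have Vc := adm_continuous aV.
rewrite (arrival_meanB _ _ _ _ Vc Vc) /win_gain (pos_part_id q0) pos_part_id//.
rewrite subr_ge0; apply: arrival_mean_nondecreasing => //.
exact: pos_part_subr1_le.
Qed.

End QueueCost.

(** * Growth, strict increments and extension of the holding cost *)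

Section HoldingCost.
Context {R : realType}.

Lemma bernoulli_ineq (h : R) n : 0 <= h <= 1 -> 1 - n%:R * h <= (1 - h) ^+ n.
Proof.
move=> /andP[h0 h1]; elim: n => [|n IH]; first by rewrite mul0r subr0 expr0.
have h1' : 0 <= 1 - h by lra.
rewrite exprS; apply: (le_trans _ (ler_wpM2l h1' IH)).
have nh : 0 <= n%:R * h * h by rewrite !mulr_ge0.
by rewrite -natr1; lra.
Qed.

(** Each of the [n.+1] terms of [1 + x + ... + x ^+ n] is at least [x ^+ n], and the sum times
    [1 - x] is [1 - x ^+ n.+1]. *)
Lemma geometric_linear_le (x : R) n : 0 <= x < 1 -> (n.+1)%:R * x ^+ n * (1 - x) <= 1.
Proof.
move=> /andP[x0 x1].
suff : (n.+1)%:R * x ^+ n * (1 - x) <= 1 - x ^+ n.+1.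
  by have := exprn_ge0 n.+1 x0; lra.
elim: n => [|n IH]; first by rewrite expr0 expr1; lra.
have x1' : 0 <= 1 - x by lra.
have xn0 : 0 <= x ^+ n.+1 by exact: exprn_ge0.
have xn1 : x ^+ n.+1 <= 1 by apply: exprn_ile1 => //; exact: ltW.
have := ler_wpM2l x0 IH.
have := mulr_ge0 x1' (_ : 0 <= 1 - x ^+ n.+1) => /(_ _).
rewrite subr_ge0 => /(_ xn1).
rewrite !exprS -(natr1 n.+1); move: (x ^+ n) (n.+1%:R : R) => y z; lra.
Qed.

(* With [x ^ (m + 1) >= beta], split [x ^ ((m + 1) n)] as [x ^ n * (x ^ n) ^ m]. *)
Lemma geometric_poly_le (beta : R) m : 0 < beta < 1 ->
  exists K x : R, [/\ 0 <= K, 0 <= x < 1 &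
    forall n, beta ^+ n * (n.+1)%:R ^+ m <= K * x ^+ n].
Proof.
(* Chosen so that the Bernoulli lower bound for [x ^+ m.+1] is exactly [beta]. *)
move=> /andP[b0 b1]; pose h := (1 - beta) / m.+1%:R; pose x := 1 - h.
have m0 : (0 : R) < m.+1%:R by rewrite ltr0n.
have h0 : 0 < h by rewrite divr_gt0// subr_gt0.
have h1 : h < 1.
  rewrite /h ltr_pdivrMr// mul1r; apply: (@lt_le_trans _ _ 1); first lra.
  by rewrite ler1n.
have x01 : 0 <= x < 1 by rewrite /x; lra.
have /andP[x0 x1] := x01.
have bx : beta <= x ^+ m.+1.
  apply: (le_trans _ (bernoulli_ineq m.+1 (_ : 0 <= h <= 1))); last by lra.
  by rewrite /h mulrC divfK ?gt_eqF//; lra.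
exists ((1 - x)^-1 ^+ m), x; split => //.
  by rewrite exprn_ge0// invr_ge0; lra.
move=> n; apply: (@le_trans _ _ ((x ^+ m.+1) ^+ n * n.+1%:R ^+ m)).
  apply: ler_wpM2r; first exact: exprn_ge0.
  by apply: lerXn2r; rewrite ?nnegrE ?exprn_ge0//; exact: ltW.
rewrite -exprM mulnC exprM exprSr mulrAC [X in _ <= X]mulrC -mulrA mulrC.
rewrite mulrA -exprMn ler_wpM2r ?exprn_ge0//.
have x1' : 0 < 1 - x by rewrite subr_gt0.
apply: lerXn2r; rewrite ?nnegrE ?mulr_ge0 ?exprn_ge0 ?invr_ge0//; first exact: ltW.
rewrite -[X in _ <= X]mul1r ler_pdivlMr// (mulrC (x ^+ n)).
exact: geometric_linear_le.
Qed.

Context (C : R -> R).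
Hypothesis hC : holding_cost C.

Local Notation c := (fun x => C (pos_part x)).

(** If [C y <= C x], strict convexity puts the midpoint value strictly below [C x], against
    monotonicity. *)
Lemma holding_cost_increasing x y : 0 <= x -> x < y -> C x < C y.
Proof.
have [_ _ Cmono Cconv _] := hC; move=> x0 xy.
have y0 : 0 <= y by lra.
rewrite ltNge; apply/negP => Cyx.
have Dx : `[0, +oo[%classic x by rewrite /= in_itv/= andbT.
have Dy : `[0, +oo[%classic y by rewrite /= in_itv/= andbT.
have := Cconv x y (2^-1) Dx Dy.
rewrite lt_eqF// invr_gt0 invf_lt1// ltr1n ltr0n => /(_ isT isT isT).
have : C x <= C (2^-1 * x + (1 - 2^-1) * y) by apply: Cmono; lra.
lra.
Qed.

Lemma holding_cost_increment_above1 x y : 1 <= x -> x < y ->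
  C x - C (x - 1) < C y - C (y - 1).
Proof.
have [_ _ _ Cconv _] := hC; move=> x1 xy.
have Dx : `[0, +oo[%classic (x - 1) by rewrite /= in_itv/= andbT; lra.
have Dy : `[0, +oo[%classic y by rewrite /= in_itv/= andbT; lra.
(* [x] and [y - 1] are the combinations of [x - 1] and [y] with weights [t], [1 - t] and the
   reverse; adding the two convexity inequalities cancels [t]. *)
pose t := (y - x) / (y - x + 1).
have d0 : 0 < y - x + 1 by lra.
have t0 : 0 < t by rewrite divr_gt0//; lra.
have t1 : t < 1 by rewrite ltr_pdivrMr//; lra.
have tE : t * (y - x + 1) = y - x by rewrite /t divfK// gt_eqF.
have ne : x - 1 != y by rewrite lt_eqF//; lra.
have := Cconv _ _ t Dx Dy ne t0 t1.
have := Cconv _ _ (1 - t) Dx Dy ne.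
rewrite subr_gt0 => /(_ t1); rewrite gtrBl => /(_ t0).
have -> : t * (x - 1) + (1 - t) * y = x by lra.
have -> : (1 - t) * (x - 1) + (1 - (1 - t)) * y = y - 1 by lra.
lra.
Qed.

Lemma holding_cost_increment x y : 0 <= x -> x < y ->
  C x - C (pos_part (x - 1)) < C y - C (pos_part (y - 1)).
Proof.
have below (x' y' : R) : 0 <= x' -> x' < y' -> y' <= 1 ->
    C x' - C (pos_part (x' - 1)) < C y' - C (pos_part (y' - 1)).
  move=> x0 xy y1; rewrite !(@pos_part_le0 _ (_ - 1)); try lra.
  by rewrite ltrD2r; exact: holding_cost_increasing.
have above (x' y' : R) : 1 <= x' -> x' < y' ->
    C x' - C (pos_part (x' - 1)) < C y' - C (pos_part (y' - 1)).
  move=> x1 xy; rewrite !pos_part_id; try lra.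
  exact: holding_cost_increment_above1.
move=> x0 xy; have [y1|y1] := leP y 1; first exact: below.
have [x1|x1] := ltP x 1; last exact: above.
by apply: (@lt_trans _ _ (C 1 - C (pos_part (1 - 1)))); [exact: below|exact: above].
Qed.

(** The extension is constant on the left of 0, so right continuity is enough there. *)
Lemma continuous_ext_pos_part (f : R -> R) : {within `[0, +oo[, continuous f} ->
  continuous (fun x => f (pos_part x)).
Proof.
move=> fc x; apply/cvgrPdist_le => /= e e0.
have /continuous_within_itvcyP[fi f0] := fc.
have [x0|x0|x0] := ltgtP x 0.
- near=> y; have y0 : y < 0 by near: y; exact: lt_nbhsl.
  rewrite (pos_part_le0 (ltW x0)) (pos_part_le0 (ltW y0)) subrr normr0; exact: ltW.
- have fx : f y @[y --> x] --> f x by apply: fi; rewrite in_itv/= x0.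
  near=> y; have y0 : 0 < y by near: y; exact: lt_nbhsr.
  rewrite (pos_part_id (ltW x0)) (pos_part_id (ltW y0)); near: y.
  by move/cvgrPdist_le : fx; apply.
- rewrite x0 [pos_part 0]pos_part_id//.
  have /cvgrPdist_le/(_ e e0) := f0.
  rewrite near_withinE => h; near=> y.
  have [y0|y0] := leP y 0; first by rewrite pos_part_le0// subrr normr0; exact: ltW.
  rewrite (pos_part_id (ltW y0)); move: y0; near: y.
  exact: h.
Unshelve. all: by end_near. Qed.

Lemma within_continuous_eq (f g : R -> R) : continuous g ->
  (forall x, 0 <= x -> f x = g x) -> {within `[0, +oo[, continuous f}.
Proof.
move=> gc fg; apply: (@subspace_eq_continuous _ _ _ g); last exact: continuous_subspaceT.
by move=> x; rewrite inE/= in_itv/= andbT => x0; exact/esym/fg.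
Qed.

Lemma adm_holding_cost : admissible c.
Proof.
have [C0 Cc Cmono _ _] := hC; split.
- exact: continuous_ext_pos_part.
- by move=> q; apply: C0; exact: pos_part_ge0.
- move=> x y xy; apply: Cmono; first exact: pos_part_ge0.
  exact: pos_part_nondecreasing.
- move=> x y x0; rewrite le_eqVlt => /orP[/eqP->//|xy].
  have y0 : 0 <= y by apply: le_trans (ltW xy).
  rewrite !(pos_part_id (pos_part_ge0 _)) (pos_part_id x0) (pos_part_id y0).
  exact/ltW/holding_cost_increment.
Qed.

Lemma holding_cost_growth (beta a : R) : 0 < beta < 1 -> 0 <= a ->
  forall B : R, exists K gamma : R, [/\ 0 <= K, 0 <= gamma < 1 &
    forall k q, q <= B -> beta ^+ k * c (pos_part q + k%:R * a) <= K * gamma ^+ k].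
Proof.
move=> b01 a0 B; have [_ _ Cmono _ [m [k [N [_ HN]]]]] := hC.
have [K [x [K0 x01 HK]]] := geometric_poly_le m b01.
(* [L] dominates [q] and exceeds the threshold [N] of the growth bound. Then
   [L + n * a <= (L + a) * (n + 1)] isolates the power of [n.+1]. *)
pose L := `|B| + `|N| + 1.
have L0 : 0 < L by rewrite /L ltr_wpDl.
exists (`|k| * (L + a) ^+ m * K), x; split => //.
  by rewrite !mulr_ge0// exprn_ge0// addr_ge0// ltW.
move=> n q qB.
have na0 : 0 <= n%:R * a by rewrite mulr_ge0.
have qL : pos_part q + n%:R * a <= L + n%:R * a.
  rewrite lerD2r /pos_part ge_max (ltW L0) andbT (le_trans qB)// /L.
  by have := ler_norm B; have := normr_ge0 N; lra.
have NL : N < L + n%:R * a.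
  by rewrite /L; have := ler_norm N; have := normr_ge0 B; lra.
have b0 : 0 <= beta ^+ n by apply: exprn_ge0; lra.
apply: (@le_trans _ _ (beta ^+ n * (`|k| * (L + a) ^+ m * n.+1%:R ^+ m))).
  apply: ler_wpM2l => //; rewrite pos_part_id ?addr_ge0 ?pos_part_ge0//.
  apply: (@le_trans _ _ (C (L + n%:R * a))).
    by apply: Cmono => //; rewrite addr_ge0// pos_part_ge0.
  apply: (le_trans (HN _ NL)).
  have La : 0 <= L + n%:R * a by rewrite addr_ge0// ltW.
  apply: (@le_trans _ _ (`|k| * (L + n%:R * a) ^+ m)).
    by apply: ler_wpM2r; [exact: exprn_ge0|exact: ler_norm].
  rewrite -mulrA ler_wpM2l// -exprMn; apply: lerXn2r; rewrite ?nnegrE//.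
    by rewrite mulr_ge0// addr_ge0// ltW.
  rewrite -natr1; have nL : 0 <= n%:R * L by rewrite mulr_ge0// ltW.
  by lra.
rewrite mulrCA -[X in _ <= X]mulrA ler_wpM2l//.
by rewrite mulr_ge0// exprn_ge0// addr_ge0// ltW.
Qed.

End HoldingCost.

(** * Regularity of the win probability *)

Section WinProbability.
Context {R : realType} (E : R) (rho : R -> R).
Hypothesis hrho : bid_cdf E rho.

Lemma bid_cdf_range x : 0 <= rho x <= 1.
Proof.
have [[mu _ rhoE] _ _] := hrho.
by rewrite -!lee_fin rhoE measure_ge0 probability_le1.
Qed.

Lemma bid_cdf_nondecreasing x y : x <= y -> rho x <= rho y.
Proof.
have [[mu _ rhoE] _ _] := hrho; move=> xy.
by rewrite -lee_fin !rhoE le_measure ?inE//; apply: subset_itvl; rewrite bnd_simp.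
Qed.

Lemma win_prob_range M x : 0 <= win_prob M rho x <= 1.
Proof.
have /andP[r0 r1] := bid_cdf_range x.
by rewrite exprn_ge0//= exprn_ile1.
Qed.

Lemma win_prob_nondecreasing M x y : x <= y -> win_prob M rho x <= win_prob M rho y.
Proof.
move=> xy; have /andP[r0 _] := bid_cdf_range x; have /andP[r0' _] := bid_cdf_range y.
by apply: lerXn2r; rewrite ?nnegrE//; exact: bid_cdf_nondecreasing.
Qed.

Lemma continuous_win_prob M : continuous (win_prob M rho).
Proof.
have [_ rc _] := hrho => x.
by apply: (continuous_comp (f := rho) (g := fun z => z ^+ (M - 1))); [exact: rc|exact: exprn_continuous].
Qed.

End WinProbability.

(** * Regularity of the value function and of the best bid *)

Theorem lemma4 (R : realType) (M : nat) (beta Abar E : R)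
    (Phi : probability R R) (C rho : R -> R)
    (d : measure_display) (Omega : measurableType d)
    (P : probability Omega R) (A U : nat -> {RV P >-> R})
    (hM : (2 <= M)%N) (hbeta : 0 < beta < 1)
    (hPhi : distribution_on Phi 0 Abar) (hdens : has_bounded_density Phi)
    (hC : holding_cost C) (hrho : bid_cdf E rho)
    (hAU : queue_inputs Phi A U) :
  [/\ forall q, 0 <= q -> value_ereal A U M beta C rho q \is a fin_num,
      {within `[0, +oo[, continuous (value A U M beta C rho)} &
      forall x y, 0 <= x -> x <= y ->
        value A U M beta C rho x <= value A U M beta C rho y]
  /\
  {within `[0, +oo[, continuous (best_bid A U M beta C rho Phi Abar)} /\
  (forall x y, 0 <= x -> x < y ->
     best_bid A U M beta C rho Phi Abar x
     < best_bid A U M beta C rho Phi Abar y).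
Proof.
have pc := @continuous_win_prob _ _ _ hrho M.
have pm := @win_prob_nondecreasing _ _ _ hrho M.
have pr := win_prob_range hrho M.
have ac := adm_holding_cost hC.
have gc := holding_cost_growth hC hbeta (Abar_ge0 hPhi).
have aV := adm_value_lim pc pm pr hPhi hbeta ac gc.
have vE := value_erealE hAU hPhi hbeta pc pm pr ac gc.
have valE := valueE hAU hPhi hbeta pc pm pr ac gc.
have bidE := best_bidE hAU hPhi hbeta pc pm pr ac gc.
split; [split|split].
- by move=> q q0; rewrite vE.
- exact: within_continuous_eq (adm_continuous aV) valE.
- move=> x y x0 xy; rewrite !valE//; last exact: le_trans xy.
  exact: adm_nondecreasing aV _ _ xy.
- apply: within_continuous_eq bidE.
  exact: continuous_win_gain.
- move=> x y x0 xy; have y0 := le_trans x0 (ltW xy).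
  rewrite (bidE x x0) (bidE y y0).
  apply: (win_gain_value_lim_increasing pc pm pr hPhi hbeta ac gc) => //.
    move=> u v u0 uv; rewrite (pos_part_id u0) (pos_part_id (le_trans u0 (ltW uv))).
    exact: holding_cost_increasing.
  move=> u v u0 uv; rewrite !(pos_part_id (pos_part_ge0 _)).
  rewrite (pos_part_id u0) (pos_part_id (le_trans u0 (ltW uv))).
  exact: holding_cost_increment.
Qed.
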